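(* Let $f:\mathcal{X}\to\mathcal{Y}$ be a deterministic probabilistic black-box classifier, where $\mathcal{Y}$ is the set of $n$-dimensional probability vectors, and let $C\subseteq\{1,\ldots,n\}$ be the set of classes to be explained. Let $\mathcal{X}^\prime=\{0,1\}^d$ be a binary interpretable domain whose interpretable representation transformation function $\mathit{IR}:\mathcal{X}\to\mathcal{X}^\prime$, with inverse transformation $\mathit{IR}^{-1}:\mathcal{X}^\prime\to\mathcal{X}$, is deterministic. Let $g$ be a surrogate binary multi-output regression tree, fitted to all points of $\mathcal{X}^\prime$ with targets $\bigl(f_c(\mathit{IR}^{-1}(x^\prime))\bigr)_{c\in C}$, whose width (number of leaves) equals the cardinality of $\mathcal{X}^\prime$, i.e., $$\Omega(g;d)=\frac{\mathrm{width}(g)}{2^d}=\frac{2^d}{2^d}=1 .$$ Then $g$ achieves full fidelity, with respect to both data-driven explanations (derived from any data point in the interpretable representation) and model-driven explanations (derived from the structure of the tree). That is, $$f_c\bigl(\mathit{IR}^{-1}(x^\prime)\bigr)=g_c(x^\prime)\qquad\text{for all } c\in C \text{ and all } x^\prime\in\mathcal{X}^\prime,$$ and in particular this equality holds for all $x^\prime$ in the minimal representation set $X^\prime_{\mathit{min},T}$ of the tree.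
   Context: Trees. A binary multi-output regression tree $g$ on $\mathcal{X}^\prime=\{0,1\}^d$ ($d\ge1$) is a finite rooted binary tree. Each internal node tests one coordinate by $x^\prime_i<1/2$, sending points with $x^\prime_i=0$ to one child and points with $x^\prime_i=1$ to the other. Each leaf $t$ in the set of leaves $T$ carries real values $(v_{t,c})_{c\in C}$. Write $g_{\mathit{id}}(x^\prime)\in T$ for the leaf reached by $x^\prime$. The prediction is $g_c(x^\prime)=v_{g_{\mathit{id}}(x^\prime),c}$. Every leaf is assumed to be reached by at least one point of $\mathcal{X}^\prime$. The width of $g$ is $\mathrm{width}(g)=|T|$, and its width-based complexity is $\Omega(g;d)=\mathrm{width}(g)/2^d$. Fitting. The tree is fitted to the full set $\mathcal{X}^\prime$ with strictly positive sample weights $\omega(x^\prime)$. This means that the value of leaf $t$ for class $c$ is the weighted mean of the targets of the points reaching it: $$v_{t,c}=\frac{\sum_{x^\prime:\,g_{\mathit{id}}(x^\prime)=t}\omega(x^\prime)\,f_c(\mathit{IR}^{-1}(x^\prime))}{\sum_{x^\prime:\,g_{\mathit{id}}(x^\prime)=t}\omega(x^\prime)} .$$ Minimal representation. For a leaf $t\in T$, $x^\prime_{\mathit{min},t}$ is the (unique) point of $\mathcal{X}^\prime$ maximising $\sum_{i=1}^d x^\prime_i$ subject to $g_{\mathit{id}}(x^\prime)=t$, and $X^\prime_{\mathit{min},T}=\{x^\prime_{\mathit{min},t}:t\in T\}$. Deterministic interpretable representation. $\mathit{IR}$ and $\mathit{IR}^{-1}$ are (single-valued, non-random) functions with $\mathit{IR}(\mathit{IR}^{-1}(x^\prime))=x^\prime$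 for every $x^\prime\in\mathcal{X}^\prime$. Deterministic black box means that $f$ is a genuine function, and $f_c(x)$ denotes the $c$-th component of $f(x)$. *)

(* Defs.v *)
From HB Require Import structures.
From mathcomp Require Import all_boot all_order all_algebra.
From mathcomp Require Import reals.
Set Implicit Arguments.
Unset Strict Implicit.
Unset Printing Implicit Defensive.
Import Order.TTheory GRing.Theory Num.Theory.
Local Open Scope ring_scope.

Record prob_vector (R : realType) (n : nat) := ProbVector {
  prob_val :> 'rV[R]_n;
  prob_ge0 : forall i, 0 <= prob_val 0 i;
  prob_sum1 : \sum_i prob_val 0 i = 1
}.

(* {0,1}^d; [false] stands for 0 and [true] for 1. *)
Definition bpoint (d : nat) := {ffun 'I_d -> bool}.

Inductive tree_shape (d : nat) :=
| Leaf
| Node (i : 'I_d) (l r : tree_shape d).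

(* The set T of leaves, as a type: a leaf of [Node i l r] is a leaf of [l] or
   a leaf of [r]. *)
Fixpoint leaf (d : nat) (s : tree_shape d) : finType :=
  match s with
  | Leaf => unit
  | Node _ l r => (leaf l + leaf r)%type
  end.

(* The test [x_i < 1/2] succeeds exactly when [x i = false]; such points go to
   the left child. *)
Fixpoint shape_leaf (d : nat) (s : tree_shape d) (x : bpoint d) : leaf s :=
  match s return leaf s with
  | Leaf => tt
  | Node i l r => if x i then inr (shape_leaf r x) else inl (shape_leaf l x)
  end.

(* [K] indexes the outputs. *)
Record regression_tree (R : realType) (d : nat) (K : Type) := RegressionTree {
  shape : tree_shape d;
  leaf_value : leaf shape -> K -> R
}.

Section RegressionTree.
Variables (R : realType) (d : nat) (K : Type) (g : regression_tree R d K).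

Definition g_id (x : bpoint d) : leaf (shape g) := shape_leaf (shape g) x.

Definition predict (c : K) (x : bpoint d) : R := leaf_value (g_id x) c.

Definition all_leaves_reached : Prop :=
  forall t : leaf (shape g), exists x, g_id x = t.

Definition width : nat := #|leaf (shape g)|.

Definition complexity : R := width%:R / 2%:R ^+ d.

Definition fitted (omega : bpoint d -> R) (target : K -> bpoint d -> R) : Prop :=
  forall (t : leaf (shape g)) (c : K),
    leaf_value t c = (\sum_(x | g_id x == t) omega x * target c x)
                     / (\sum_(x | g_id x == t) omega x).

Definition ones (x : bpoint d) : nat := (\sum_(i < d) x i)%N.

(* [x] is the point x_{min,t}; [minimal_point_unique] shows that it exists and
   is unique for every leaf that is reached. *)
Definition minimal_point (t : leaf (shape g)) (x : bpoint d) : bool :=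
  (g_id x == t) && [forall y : bpoint d, (g_id y == t) ==> (ones y <= ones x)%N].

Definition minimal_representation : {set bpoint d} :=
  [set x | [exists t, minimal_point t x]].

End RegressionTree.

Section MinimalPoint.
Variables (R : realType) (d : nat) (K : Type) (g : regression_tree R d K).

Let join (x y : bpoint d) : bpoint d := [ffun i => x i || y i].

Lemma shape_leaf_join (s : tree_shape d) (x y : bpoint d) :
  shape_leaf s x = shape_leaf s y -> shape_leaf s (join x y) = shape_leaf s x.
Proof.
elim: s => [|i l IHl r IHr] //=; rewrite ffunE.
by case: (x i); case: (y i) => //= -[]; [move/IHr->|move/IHl->].
Qed.

Lemma ones_join_eq (x y : bpoint d) :
  (ones (join x y) <= ones x)%N -> join x y = x.
Proof.
have le_i i : (x i <= join x y i)%N by rewrite ffunE; case: (x i).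
move=> le_jx; apply/ffunP => i; apply/eqP.
have: ones x == ones (join x y).
  by rewrite eqn_leq le_jx andbT; apply: leq_sum => j _; apply: le_i.
rewrite /ones (leqif_sum (fun j _ => leqif_eq (le_i j))).
move/forallP/(_ i) => /=.
by case: (x i); case: (join x y i).
Qed.

Lemma minimal_point_unique (t : leaf (shape g)) :
  (exists x, g_id g x = t) -> exists! x, minimal_point t x.
Proof.
case=> x0 /eqP x0t.
case: (@arg_maxnP _ x0 (fun x => g_id g x == t) (@ones d) x0t) => x xt xmax.
exists x; split; first by rewrite /minimal_point xt; apply/forall_inP.
move=> y /andP[yt /forall_inP ymax].
have xy : g_id g x = g_id g y by rewrite (eqP xt) (eqP yt).
have jx : join x y = x.
  by apply/ones_join_eq/xmax; rewrite /g_id shape_leaf_join.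
have jy : join y x = y.
  by apply/ones_join_eq/ymax; rewrite /g_id shape_leaf_join.
by rewrite -jx -jy; apply/ffunP => i; rewrite !ffunE; case: (x i); case: (y i).
Qed.

End MinimalPoint.

(* Main.v *)
(* A surjection between finite sets of equal cardinality is injective, so each
   leaf is reached by exactly one point and its weighted mean is the target at
   that point. *)
Require Import Defs.
From HB Require Import structures.
From mathcomp Require Import all_boot all_order all_algebra.
From mathcomp Require Import reals.
Import Order.TTheory GRing.Theory Num.Theory.
Local Open Scope ring_scope.

(** The map [g_id g] is onto, since every leaf is reached, and there are as many leaves as points,
    so it is injective ([surjective_card_injective]). Each leaf then holds one point, and its
    weighted mean collapses to the target there ([predict_fitted_injective]). Fidelity on the
    minimal representation is the restriction of fidelity on the whole domain. *)

Lemma surjective_card_injective (aT rT : finType) (h : aT -> rT) :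
  (forall y, exists x, h x = y) -> #|rT| = #|aT| -> injective h.
Proof.
move=> hsurj card_eq.
have im_h : h @: aT = [set: rT].
  by apply/setP => y; rewrite inE; have [x <-] := hsurj y; rewrite imset_f.
(* [imset_injP] characterises injectivity by the image being as large as the domain. *)
have /imset_injP h_inj : #|h @: aT| == #|aT| by rewrite im_h cardsT card_eq.
by move=> x y; apply: h_inj.
Qed.

Lemma card_bpoint (d : nat) : #|{: bpoint d}| = (2 ^ d)%N.
Proof. by rewrite card_ffun card_bool card_ord. Qed.

Lemma predict_fitted_injective (R : realType) (d : nat) (K : Type)
    (g : regression_tree R d K) (omega : bpoint d -> R)
    (target : K -> bpoint d -> R) (c : K) (x : bpoint d) :
  (forall x', 0 < omega x') -> fitted g omega target -> injective (g_id g) ->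
  predict g c x = target c x.
Proof.
move=> omega_gt0 fit g_inj.
have fiber y : (g_id g y == g_id g x) = (y == x) by rewrite (inj_eq g_inj).
(* Both sums run over the fibre of the leaf of [x], which is [x] alone; what remains is
   [omega x * target c x / omega x], and positivity lets the weight cancel. *)
rewrite /predict fit !(eq_bigl _ _ fiber) !big_pred1_eq.
by rewrite mulrAC mulfV ?mul1r ?gt_eqF.
Qed.

Theorem corollary1 (R : realType) (n d : nat) (hd : (0 < d)%N)
    (X : Type) (f : X -> prob_vector R n) (C : {set 'I_n})
    (IR : X -> bpoint d) (IRinv : bpoint d -> X)
    (hIR : forall x' : bpoint d, IR (IRinv x') = x')
    (omega : bpoint d -> R) (homega : forall x', 0 < omega x')
    (g : regression_tree R d {c : 'I_n | c \in C})
    (hreach : all_leaves_reached g)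
    (hfit : fitted g omega (fun c x' => f (IRinv x') 0 (val c)))
    (hwidth : width g = #|{: bpoint d}|) :
  [/\ complexity g = 1,
      (forall (c : {c : 'I_n | c \in C}) (x' : bpoint d),
         f (IRinv x') 0 (val c) = predict g c x')
    & (forall (c : {c : 'I_n | c \in C}) (x' : bpoint d),
         x' \in minimal_representation g ->
         f (IRinv x') 0 (val c) = predict g c x')].
Proof.
have g_inj := surjective_card_injective _ _ _ hreach hwidth.
have fidelity c x' : f (IRinv x') 0 (val c) = predict g c x'.
  by rewrite (predict_fitted_injective _ _ _ _ _ _ c x' homega hfit g_inj).
split=> [|//|c x' _]; last exact: fidelity.
by rewrite /complexity hwidth card_bpoint natrX divff // expf_neq0 // pnatr_eq0.
Qed.
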